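(* Let $V\subset\mathbb{R}^d$ be a finite or countable set of isolated points, and let $W:V\to\mathbb{R}$ satisfy $W(x)>0$ for all $x\in V$ and, if $V$ is infinite, $\sum_{x\in V}|x^\alpha|\,|W(x)|<\infty$ for all $\alpha\in\mathbb{N}_0^d$. Fix a graded monomial order and let $\Lambda(V)$ be the associated index set. Then a sequence of orthonormal polynomials $\{P_\alpha:\alpha\in\Lambda(V)\}$ with respect to $W$ on $V$ exists.
   Context: $\Pi^d=\mathbb{R}[x_1,\dots,x_d]$; $\Pi^d_n$ is the space of polynomials of total degree at most $n$; $x^\alpha=x_1^{\alpha_1}\cdots x_d^{\alpha_d}$, $|\alpha|=\alpha_1+\dots+\alpha_d$. $I(V)$ is the ideal of polynomials vanishing on $V$. For the fixed graded monomial order (one refining total degree), $\langle\mathrm{LT}(I(V))\rangle$ is the ideal generated by leading terms of nonzero elements of $I(V)$; $\Lambda(V)=\{\alpha\in\mathbb{N}_0^d: x^\alpha\notin\langle\mathrm{LT}(I(V))\rangle\}$; $\mathbb{R}[V]=\mathrm{span}\{x^\alpha:\alpha\in\Lambda(V)\}$. Put $\mathbf{n}=\max\{|\alpha|:\alpha\in\Lambda(V)\}$ (possibly $\infty$), $\Lambda_k(V)=\{\alpha\in\Lambda(V):|\alpha|=k\}$, $r_k=|\Lambda_k(V)|$, and let $\mathbf{x}^k=\{x^\alpha:\alpha\in\Lambda_k(V)\}$, regarded as a column vector ordered by the monomial order. (If $\mathbf{n}=\infty$, $0\le k\le\mathbf{n}$ means all integers $k\ge 0$.) Let $\mathcal{L}(f)=\sum_{x\in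 V}f(x)W(x)$ and $\langle f,g\rangle=\mathcal{L}(fg)$, applied entrywise to matrices of polynomials; for column vectors $\mathbf f,\mathbf g$ of polynomials, $\langle\mathbf f,\mathbf g\rangle=\mathcal{L}(\mathbf f\,\mathbf g^T)$. Given polynomials $P_\alpha\in\mathbb{R}[V]\cap\Pi^d_{|\alpha|}$, $\alpha\in\Lambda(V)$, let $\mathbb{P}_k=\{P_\alpha:\alpha\in\Lambda_k(V)\}$, also regarded as a column vector. The sequence is orthogonal with respect to $W$ on $V$ if $\mathcal{L}(\mathbf{x}^l\mathbb{P}_k^T)=0$ for $l<k$ and $\mathcal{L}(\mathbf{x}^k\mathbb{P}_k^T)=S_k$ is an invertible $r_k\times r_k$ matrix, for $0\le k\le\mathbf{n}$. It is orthonormal if in addition $\mathcal{L}(\mathbb{P}_k\mathbb{P}_k^T)=I_{r_k}$ (identity matrix) for $0\le k\le\mathbf{n}$. *)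

(* Defs.v *)
(* [mpoly] has to be imported before the
   analysis files: in the other order their notations clash. *)
From HB Require Import structures.
From mathcomp Require Import all_boot all_order all_algebra.
From mathcomp Require Import mpoly.
From mathcomp Require Import boolp classical_sets functions cardinality.
From mathcomp Require Import reals ereal topology normedtype numfun esum.

Set Implicit Arguments.
Unset Strict Implicit.
Unset Printing Implicit Defensive.

Import Order.TTheory GRing.Theory Num.Theory.
Import numFieldNormedType.Exports.

Local Open Scope classical_set_scope.
Local Open Scope ring_scope.

Record monomial_order (d : nat) (ord : rel 'X_{1..d}) : Prop := MonomialOrder {
  mord_refl : reflexive ord;
  mord_anti : antisymmetric ord;
  mord_trans : transitive ord;
  mord_total : total ord;
  mord_addr : forall a b c : 'X_{1..d}, ord a b -> ord (a + c)%MM (b + c)%MM;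
  mord_wf : well_founded (fun a b : 'X_{1..d} => (a != b) && ord a b)
}.

Record graded_monomial_order (d : nat) (ord : rel 'X_{1..d}) : Prop :=
  GradedMonomialOrder {
  gmord_order : monomial_order ord;
  gmord_graded : forall a b : 'X_{1..d}, (mdeg a < mdeg b)%N -> ord a b
}.

Record is_ideal (A : comNzRingType) (I : set A) : Prop := IsIdeal {
  ideal0 : I 0;
  idealD : forall a b : A, I a -> I b -> I (a + b);
  idealM : forall c a : A, I a -> I (c * a)
}.

Definition ideal_generated (A : comNzRingType) (G : set A) : set A :=
  smallest (@is_ideal A) G.

Definition linear_span (F : fieldType) (M : lmodType F) (G : set M) : set M :=
  [set v | exists (n : nat) (c : 'I_n -> F) (g : 'I_n -> M),
     (forall i, G (g i)) /\ v = \sum_(i < n) c i *: g i].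

Section VanishingIdeal.
Context {R : realType} {d : nat}.
Implicit Types (ord : rel 'X_{1..d}) (V : set 'rV[R]_d).

Definition eval_at (p : {mpoly R[d]}) (x : 'rV[R]_d) : R := p.@[x ord0].

Definition vanishing_ideal V : set {mpoly R[d]} :=
  [set p | forall x, V x -> eval_at p x = 0].

(* [t] is the leading term (coefficient included) of the nonzero polynomial
   [p]; no [t] satisfies this when [p = 0]. *)
Definition is_leading_term ord (p t : {mpoly R[d]}) : Prop :=
  exists2 m : 'X_{1..d},
    m \in msupp p /\ (forall m', m' \in msupp p -> ord m' m) &
    t = p@_m *: 'X_[m].

Definition leading_terms ord (I : set {mpoly R[d]}) : set {mpoly R[d]} :=
  [set t | exists p, [/\ I p, p != 0 & is_leading_term ord p t]].

Definition Lambda ord V : set 'X_{1..d} :=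
  [set a | ~ ideal_generated (leading_terms ord (vanishing_ideal V)) 'X_[a]].

(* R[V] *)
Definition coord_space ord V : set {mpoly R[d]} :=
  linear_span [set ('X_[a] : {mpoly R[d]}) | a in Lambda ord V].

(* Polynomials of total degree at most [n]; [msize p] is 1 + the total degree
   of [p], and 0 for [p = 0]. *)
Definition Pi_le (n : nat) : set {mpoly R[d]} :=
  [set p | (msize p <= n.+1)%N].

(* The maximal degree in [Lambda ord V]: [+oo] if [Lambda ord V] is infinite,
   and [-oo] if it is empty, i.e. if [V] is empty. *)
Definition max_deg ord V : \bar R :=
  ereal_sup [set ((mdeg a)%:R : R)%:E | a in Lambda ord V].

(* The elements of degree [k] of [Lambda ord V], in increasing order. *)
Definition Lambda_layer ord V (k : nat) : seq 'X_{1..d} :=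
  sort ord [seq a <- [seq bmnm b | b : 'X_{1..d < k.+1}] |
              (mdeg a == k) && `[< Lambda ord V a >]].

Lemma mem_Lambda_layer ord V k (a : 'X_{1..d}) :
  (a \in Lambda_layer ord V k) = (mdeg a == k) && `[< Lambda ord V a >].
Proof.
rewrite mem_sort mem_filter; apply/andP/idP => [[]//|aP].
split=> //; have /andP[/eqP dk _] := aP.
have lt_a : (mdeg a < k.+1)%N by rewrite dk.
by apply/mapP; exists (BMultinom lt_a); rewrite ?mem_enum.
Qed.

Lemma Lambda_layer_uniq ord V k : uniq (Lambda_layer ord V k).
Proof.
by rewrite sort_uniq filter_uniq // map_inj_uniq ?enum_uniq //; apply: val_inj.
Qed.

Definition layer_size ord V k : nat := size (Lambda_layer ord V k).

Definition layer_nth ord V k (i : 'I_(layer_size ord V k)) : 'X_{1..d} :=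
  tnth (in_tuple (Lambda_layer ord V k)) i.

Definition monomial_col ord V k : 'cV[{mpoly R[d]}]_(layer_size ord V k) :=
  \col_i 'X_[layer_nth i].

Definition poly_col ord V (P : 'X_{1..d} -> {mpoly R[d]}) k :
    'cV[{mpoly R[d]}]_(layer_size ord V k) :=
  \col_i P (layer_nth i).

(* The sum over [V] of [f x * W x].  As [\esum] is meant for nonnegative
   terms, an absolutely convergent family is summed as the difference of the
   sums of its positive and negative parts. *)
Definition Lfun V (W : 'rV[R]_d -> R) (f : {mpoly R[d]}) : R :=
  let g := fun x => (eval_at f x * W x)%:E in
  fine (\esum_(x in V) (g^\+)%E x - \esum_(x in V) (g^\- )%E x)%E.

(* <f, g> = L(f g^T), entrywise. *)
Definition pairing V (W : 'rV[R]_d -> R) (m n : nat)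
    (f : 'cV[{mpoly R[d]}]_m) (g : 'cV[{mpoly R[d]}]_n) : 'M[R]_(m, n) :=
  map_mx (Lfun V W) (f *m g^T).

Definition orthogonal_polys ord V (W : 'rV[R]_d -> R)
    (P : 'X_{1..d} -> {mpoly R[d]}) : Prop :=
  (forall a, Lambda ord V a -> (coord_space ord V `&` Pi_le (mdeg a)) (P a)) /\
  (forall k : nat, ((k%:R : R)%:E <= max_deg ord V)%E ->
     (forall l : nat, (l < k)%N ->
        pairing V W (monomial_col ord V l) (poly_col ord V P k) = 0) /\
     pairing V W (monomial_col ord V k) (poly_col ord V P k) \in unitmx).

Definition orthonormal_polys ord V (W : 'rV[R]_d -> R)
    (P : 'X_{1..d} -> {mpoly R[d]}) : Prop :=
  orthogonal_polys ord V W P /\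
  (forall k : nat, ((k%:R : R)%:E <= max_deg ord V)%E ->
     pairing V W (poly_col ord V P k) (poly_col ord V P k) = 1%:M).

End VanishingIdeal.

(* Main.v *)
From HB Require Import structures.
Require Import Defs.
From mathcomp Require Import all_boot all_order all_algebra.
From mathcomp Require Import mpoly.
From mathcomp Require Import boolp classical_sets functions cardinality.
From mathcomp Require Import reals ereal topology normedtype numfun esum.
From mathcomp Require Import ring lra.
Import numFieldNormedType.Exports.
Local Open Scope classical_set_scope.
Local Open Scope ring_scope.

(** Absolute convergence makes [L f = \sum_(x in V) f x * W x] a linear form on
    polynomials, and positivity of the weight makes it positive semidefinite,
    [L (p * p) = 0] holding only for [p] in the vanishing ideal of [V].  A
    nonzero polynomial whose monomials all have exponents in [Lambda ord V]
    cannot lie in that ideal, because its leading monomial would be one of the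
    excluded ones ([vanishing_standard_eq0]).  Hence [L (p * q)] is an inner
    product on the span of the standard monomials.

    No recursion along the order is needed to orthogonalize: [P a] is the
    normalized difference between ['X_[a]] and its orthogonal projection onto
    the span of the standard monomials strictly before [a].  There are finitely
    many of these since the order is graded, so the projection comes from
    inverting a finite Gram matrix ([orthogonal_projection]).  By construction
    [P a] is orthogonal to every earlier standard monomial, hence to every
    earlier [P b], which gives orthonormality and the vanishing of the pairings
    with the lower layers.  Within one layer the same fact makes the matrix of
    pairings of monomials with polynomials triangular, with a nonzero diagonal,
    hence invertible. *)

Set Implicit Arguments.
Unset Strict Implicit.
Unset Printing Implicit Defensive.
Import Order.TTheory GRing.Theory Num.Theory.

(** * Linearity of absolutely convergent signed sums *)

Section SignedSums.
Context {R : realType} {T : choiceType}.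
Implicit Types (D : set T) (f g : T -> R) (u v : T -> \bar R).

(** Stated for functions on an arbitrary index type, so that the linearity of
    [Lfun] reduces to facts about sums in which no polynomial occurs. *)
Definition signed_sum D f : R :=
  let u := EFin \o f in
  fine (\esum_(x in D) (u^\+)%E x - \esum_(x in D) (u^\- )%E x)%E.

Lemma esumZl D (c : R) u : 0 <= c -> (forall x, 0 <= u x)%E ->
  (\esum_(x in D) (c%:E * u x) = c%:E * \esum_(x in D) u x)%E.
Proof.
move=> c0 u0; rewrite /esum -ereal_supZl//; last first.
  by apply/set0P; eexists; exists set0; [exact: fsets_set0|].
congr ereal_sup; rewrite image_comp; apply: eq_imagel => A _ /=.
by rewrite ge0_mule_fsumr.
Qed.

Lemma summableZ D (c : R) u :
  summable D u -> summable D (fun x => (c%:E * u x)%E).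
Proof.
rewrite /summable => su; under eq_esum do rewrite abseM.
by rewrite esumZl// lte_mul_pinfty.
Qed.

Lemma esum_fin_num D u : (forall x, D x -> 0 <= u x)%E -> summable D u ->
  (\esum_(x in D) u x)%E \is a fin_num.
Proof.
move=> u0; rewrite summableE; congr (_ \is a fin_num).
by apply: eq_esum => x Dx; rewrite gee0_abs ?u0.
Qed.

(** The decomposition of [f] as a difference of nonnegative summable functions
    need not be the one into positive and negative parts; this freedom is what
    gives additivity, as the positive part is not additive. *)
Lemma signed_sum_sub D u v f :
  (forall x, D x -> 0 <= u x)%E -> (forall x, D x -> 0 <= v x)%E ->
  summable D u -> summable D v ->
  (forall x, D x -> (f x)%:E = (u x - v x)%E) ->
  signed_sum D f = fine (\esum_(x in D) u x)%E - fine (\esum_(x in D) v x)%E.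
Proof.
move=> u0 v0 su sv fE; rewrite /signed_sum.
rewrite (eq_esum (a := (EFin \o f)^\+%E) (b := (u \- v)^\+%E)); last first.
  by move=> x Dx; rewrite !funeposE /= fE.
rewrite (eq_esum (a := (EFin \o f)^\-%E) (b := (u \- v)^\-%E)); last first.
  by move=> x Dx; rewrite !funenegE /= EFinN fE.
by rewrite esumB// fineB//; apply: esum_fin_num.
Qed.

Lemma signed_sumE D f : summable D (EFin \o f) ->
  signed_sum D f = fine (\esum_(x in D) (EFin \o f)^\+%E x)%E
                   - fine (\esum_(x in D) (EFin \o f)^\-%E x)%E.
Proof.
move=> sf; apply: signed_sum_sub => //.
- exact: summable_funepos.
- exact: summable_funeneg.
- by move=> x _; exact: (congr1 (@^~ x) (funeposneg (EFin \o f))).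
Qed.

Lemma signed_sumD D f g :
  summable D (EFin \o f) -> summable D (EFin \o g) ->
  signed_sum D (f \+ g) = signed_sum D f + signed_sum D g.
Proof.
move=> sf sg.
have [sfp sfn] := (summable_funepos sf, summable_funeneg sf).
have [sgp sgn] := (summable_funepos sg, summable_funeneg sg).
pose F := EFin \o f; pose G := EFin \o g.
rewrite (signed_sum_sub (u := (F^\+ \+ G^\+)%E) (v := (F^\- \+ G^\-)%E)).
- rewrite !esumD// !fineD; do ?exact: esum_fin_num.
  by rewrite !signed_sumE// addrACA opprD.
- by move=> x _; rewrite adde_ge0.
- by move=> x _; rewrite adde_ge0.
- exact: summableD.
- exact: summableD.
- move=> x _; rewrite /F /G !funeposE !funenegE /= -!EFin_max.
  rewrite -!EFinD; congr EFin.
  by rewrite /Num.max; do 4 case: ifP; lra.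
Qed.

Lemma signed_sumZ D (c : R) f : summable D (EFin \o f) ->
  signed_sum D (fun x => c * f x) = c * signed_sum D f.
Proof.
move=> sf.
have [sp sn] := (summable_funepos sf, summable_funeneg sf).
rewrite !signed_sumE//; last exact: (summableZ c sf).
have -> : EFin \o (fun x => c * f x) = (fun x => c%:E * (EFin \o f) x)%E by [].
have [c0|/ltW c0] := leP 0 c.
  rewrite ge0_funeposM// ge0_funenegM// !esumZl// !fineM//;
    do ?exact: esum_fin_num.
  by rewrite mulrBr.
(* A negative factor exchanges the positive and negative parts. *)
rewrite le0_funeposM// le0_funenegM// -EFinN !esumZl ?oppr_ge0//.
rewrite !fineM//; do ?exact: esum_fin_num.
by rewrite /=; ring.
Qed.

Lemma signed_sum_ge0E D f : (forall x, D x -> 0 <= f x) ->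
  summable D (EFin \o f) ->
  signed_sum D f = fine (\esum_(x in D) (f x)%:E)%E.
Proof.
move=> f0 sf.
rewrite (signed_sum_sub (u := EFin \o f) (v := cst 0%E))//=.
- by rewrite [X in _ - fine X]esum1 //= subr0.
- by rewrite /summable esum1 ?ltry// => x _; rewrite abse0.
- by move=> x _; rewrite sube0.
Qed.

Lemma signed_sum_eq0 D f : (forall x, D x -> 0 <= f x) ->
  summable D (EFin \o f) -> signed_sum D f = 0 -> forall x, D x -> f x = 0.
Proof.
move=> f0 sf; rewrite signed_sum_ge0E// => s0 x Dx.
apply/eqP; rewrite eq_le f0// andbT -lee_fin.
(* A nonnegative sum dominates each of its terms. *)
have esum0 : (\esum_(x in D) (f x)%:E = 0)%E.
  by rewrite -[LHS]fineK ?s0//; apply: esum_fin_num.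
suff : ((f x)%:E <= \esum_(x in D) (f x)%:E)%E by rewrite esum0.
apply: esum_ge; exists [set x]; last by rewrite fsbigop.fsbig_set1.
by split; [exact: finite_set1|move=> _ ->].
Qed.
End SignedSums.

(** * The weighted functional *)

Lemma summable_finite (R : realType) (T : choiceType) (D : set T) (f : T -> R) :
  finite_set D -> summable D (EFin \o f).
Proof.
move=> finD; rewrite /summable esum_fset//.
by apply: lte_sum_pinfty => x _; exact: ltry.
Qed.

Section WeightedFunctional.
Context {R : realType} {d : nat} {V : set 'rV[R]_d} {W : 'rV[R]_d -> R}.
Context (Wpos : forall x, V x -> 0 < W x).
Context (Wsum : infinite_set V -> forall a : 'X_{1..d},
  (\esum_(x in V) (`|eval_at 'X_[a] x| * `|W x|)%:E < +oo)%E).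

Lemma summable_poly (p : {mpoly R[d]}) :
  summable V (EFin \o (fun x => eval_at p x * W x)).
Proof.
have [finV|infV] := pselect (finite_set V); first exact: summable_finite.
elim/mpolyind: p => [|c m p _ _ sp].
  rewrite /summable esum1 ?ltry// => x _.
  by rewrite /= /eval_at meval0 mul0r normr0.
have -> : EFin \o (fun x => eval_at (c *: 'X_[m] + p) x * W x) =
    ((fun x => c%:E * (eval_at 'X_[m] x * W x)%:E)
     \+ (EFin \o (fun x => eval_at p x * W x)%R))%E.
  by apply/funext => x; rewrite /= /eval_at mevalD mevalZ mulrDl -mulrA.
apply: summableD sp; apply: summableZ; apply: le_lt_trans (Wsum infV m).
by apply: le_esum => x _; rewrite /= normrM.
Qed.

Lemma LfunE (p : {mpoly R[d]}) :
  Lfun V W p = signed_sum V (fun x => eval_at p x * W x).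
Proof. by []. Qed.

Lemma Lfun_scalar : scalar (Lfun V W).
Proof.
move=> c p q.
rewrite !LfunE -signed_sumZ; last exact: summable_poly.
rewrite -signed_sumD; last exact: summable_poly.
  congr signed_sum; apply/funext => x.
  by rewrite /eval_at mevalD mevalZ mulrDl -mulrA.
exact: (summableZ c (summable_poly p)).
Qed.

Let sqr_weight_ge0 (p : {mpoly R[d]}) x :
  V x -> 0 <= eval_at (p * p) x * W x.
Proof.
by move=> Vx; rewrite mulr_ge0 ?(ltW (Wpos Vx))// /eval_at mevalM -expr2 sqr_ge0.
Qed.

Lemma Lfun_sqr_ge0 (p : {mpoly R[d]}) : 0 <= Lfun V W (p * p).
Proof.
rewrite LfunE signed_sum_ge0E; [|exact: sqr_weight_ge0|exact: summable_poly].
by apply/fine_ge0/esum_ge0 => x Vx; rewrite lee_fin sqr_weight_ge0.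
Qed.

Lemma Lfun_sqr_eq0 (p : {mpoly R[d]}) :
  Lfun V W (p * p) = 0 -> vanishing_ideal V p.
Proof.
move=> /(signed_sum_eq0 (@sqr_weight_ge0 p) (summable_poly _)) p0 x Vx.
apply/eqP; have /eqP := p0 x Vx.
by rewrite /eval_at mevalM !mulf_eq0 orbb (gt_eqF (Wpos Vx)) orbF.
Qed.

End WeightedFunctional.

(** * Projection by a Gram matrix *)

Section OrthogonalProjection.
Context {F : fieldType} {A : comAlgType F} (L : {scalar A}).

(** If the bilinear form [L (x * y)] is definite on the span of the [u i], their
    Gram matrix [G] is invertible: [v *m G = 0] makes the combination with
    coefficients [v] isotropic.  The coefficients of the projection then solve
    the normal equations. *)
Lemma orthogonal_projection n (u : 'I_n -> A) (f : A) :
  (forall c : 'I_n -> F,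
     L ((\sum_i c i *: u i) * (\sum_i c i *: u i)) = 0 -> forall i, c i = 0) ->
  exists c : 'I_n -> F, forall j, L ((f - \sum_i c i *: u i) * u j) = 0.
Proof.
move=> defL; pose G := \matrix_(i, j) L (u i * u j).
have LG (v : 'rV_n) (w : A) :
    L ((\sum_i v 0 i *: u i) * w) = \sum_i v 0 i * L (u i * w).
  rewrite mulr_suml linear_sum; apply: eq_bigr => i _.
  by rewrite -scalerAl linearZ.
have Gunit : G \in unitmx.
  rewrite -row_free_unit -kermx_eq0; apply/rowV0P => v /sub_kermxP vG0.
  apply/rowP => i; rewrite mxE; move: i; apply: (defL (v 0)).
  rewrite LG big1// => i _; rewrite (mulrC (u i)) LG.
  have /rowP/(_ i) := vG0; rewrite !mxE => vGi.
  rewrite [X in _ * X](_ : _ = 0) ?mulr0// -[RHS]vGi.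
  by apply: eq_bigr => j _; rewrite mxE.
pose b := \row_j L (f * u j).
exists ((b *m invmx G) 0) => j.
rewrite mulrBl linearB /= LG; apply/eqP; rewrite subr_eq0; apply/eqP.
have /rowP/(_ j) := mulmxKV Gunit b; rewrite !mxE => <-.
by apply: eq_bigr => i _; rewrite [G i j]mxE.
Qed.
End OrthogonalProjection.

(** * Standard monomials *)

Lemma exists_greatest (T : eqType) (ord : rel T) (s : seq T) :
  reflexive ord -> transitive ord -> total ord -> s != [::] ->
  exists2 m, m \in s & forall x, x \in s -> ord x m.
Proof.
move=> refl trans tot; elim: s => // a s IH _.
have [->|/IH[m ms mmax]] := eqVneq s [::].
  by exists a; rewrite ?mem_head// => x; rewrite inE => /eqP->.
have [am|ma] := orP (tot a m).
  exists m; first by rewrite inE ms orbT.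
  by move=> x /[!inE] /predU1P[->//|/mmax].
exists a; first exact: mem_head.
by move=> x /[!inE] /predU1P[->//|/mmax xm]; apply: trans ma.
Qed.

Section StandardMonomials.
Context {R : realType} {d : nat} {ord : rel 'X_{1..d}} {V : set 'rV[R]_d}.
Implicit Types (p q : {mpoly R[d]}) (S : set 'X_{1..d}).

Definition supported_in S p : Prop := forall m, m \in msupp p -> S m.

Lemma supported_in_lincomb S n (m : 'I_n -> 'X_{1..d}) (c : 'I_n -> R) :
  (forall i, S (m i)) -> supported_in S (\sum_i c i *: 'X_[m i]).
Proof.
move=> Sm a /msupp_sum_le /flattenP[s /mapP[i _ ->]] /msuppZ_le.
by rewrite msuppX inE => /eqP ->.
Qed.

Lemma coord_space_supported p :
  supported_in (Lambda ord V) p -> coord_space ord V p.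
Proof.
move=> Sp; exists (size (msupp p)), (fun i => p@_(tnth (in_tuple (msupp p)) i)),
  (fun i => 'X_[tnth (in_tuple (msupp p)) i]); split.
  by move=> i; exists (tnth (in_tuple (msupp p)) i) => //; apply/Sp/mem_tnth.
by rewrite {1}[p]mpolyE big_tnth.
Qed.

(** Were [p] nonzero, its leading monomial would belong both to its support,
    hence to [Lambda ord V], and to the ideal of leading terms, once the leading
    coefficient is divided out. *)
Lemma vanishing_standard_eq0 p : monomial_order ord ->
  supported_in (Lambda ord V) p -> vanishing_ideal V p -> p = 0.
Proof.
move=> mord Sp Vp; apply/eqP/negPn/negP => p0.
have supp0 : (msupp p : seq _) != [::] by rewrite msupp_eq0.
have [m mp mmax] := exists_greatest (mord_refl mord) (mord_trans mord)
  (mord_total mord) supp0.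
apply: (Sp m mp) => I [idI genI].
have pm0 : p@_m != 0 by rewrite -mcoeff_msupp.
have -> : 'X_[m] = (p@_m)^-1%:MP * (p@_m *: 'X_[m]) :> {mpoly R[d]}.
  by rewrite mul_mpolyC scalerA mulVf// scale1r.
apply: (idealM idI); apply: genI; exists p; split=> //.
by exists m.
Qed.

End StandardMonomials.

(** * Orthonormalization of the standard monomials *)

Section Orthonormalization.
Context {R : realType} {d : nat} {ord : rel 'X_{1..d}} {V : set 'rV[R]_d}.
Context (gord : graded_monomial_order ord) (L : {scalar {mpoly R[d]}}).
Context (L_ge0 : forall p, 0 <= L (p * p)).
Context (L_eq0 : forall p, L (p * p) = 0 -> vanishing_ideal V p).

Let mord := gmord_order gord.

Lemma graded_mdeg a b : ord a b -> (mdeg a <= mdeg b)%N.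
Proof.
move=> ab; rewrite leqNgt; apply/negP => ba.
have ba' := gmord_graded gord ba.
by have eab : a = b; [apply: (mord_anti mord); rewrite ab|rewrite eab ltnn in ba].
Qed.

Definition standard_before (a : 'X_{1..d}) : set 'X_{1..d} :=
  [set b | Lambda ord V b /\ ord b a].

(** What the Gram-Schmidt process guarantees about its output at [a], expressed
    through the monomials alone.  No other member of the family is mentioned, so
    that each can be chosen independently of the rest. *)
Record orthonormal_at (a : 'X_{1..d}) (p : {mpoly R[d]}) : Prop := OrthonormalAt {
  oat_supp : supported_in (standard_before a) p;
  oat_norm : L (p * p) = 1;
  oat_lower : forall b, standard_before a b -> b != a -> L ('X_[b] * p) = 0;
  oat_lead : L ('X_[a] * p) != 0
}.

(** The difference [q] between ['X_[a]] and its projection [r] is nonzero because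
    its coefficient at [a] is [1], so [L (q * q)] is positive and [q] can be
    normalized.  As [q] is orthogonal to [r], pairing it with ['X_[a] = q + r]
    gives [L (q * q)] again, hence [oat_lead]. *)
Lemma orthonormal_at_exists a :
  Lambda ord V a -> exists p, orthonormal_at a p.
Proof.
move=> La.
(* Gradedness bounds the degree of the exponents before [a], so that they can
   be enumerated. *)
pose s := [seq b <- [seq bmnm b | b : 'X_{1..d < (mdeg a).+1}] |
  `[< standard_before a b >] && (b != a)].
have memS b : (b \in s) = `[< standard_before a b >] && (b != a).
  rewrite mem_filter; apply/andP/idP => [[]//|ba]; split=> //.
  have /andP[/asboolP[_ /graded_mdeg ab] _] := ba.
  have {}ab : (mdeg b < (mdeg a).+1)%N by [].
  by apply/mapP; exists (BMultinom ab); rewrite ?mem_enum.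
have uniqS : uniq s.
  by rewrite filter_uniq// map_inj_uniq ?enum_uniq//; apply: val_inj.
pose m i := tnth (in_tuple s) i.
have mS i : standard_before a (m i) /\ m i != a.
  by have := mem_tnth i (in_tuple s); rewrite memS => /andP[/asboolP].
have m_inj : injective m by apply/tuple_uniqP.
have suppm (c : 'I_(size s) -> R) :
    supported_in (standard_before a) (\sum_i c i *: 'X_[m i]).
  by apply: supported_in_lincomb => i; case: (mS i).
have ma (c : 'I_(size s) -> R) : (\sum_i c i *: 'X_[m i])@_a = 0.
  rewrite linear_sum big1// => i _ /=.
  by rewrite mcoeffZ mcoeffX (negPf (mS i).2) mulr0.
have std0 p : supported_in (standard_before a) p -> L (p * p) = 0 -> p = 0.
  move=> Sp /L_eq0; apply: (vanishing_standard_eq0 mord).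
  by move=> b /Sp[].
have [|c cP] := @orthogonal_projection _ _ L _ (fun i => 'X_[m i]) 'X_[a].
  move=> c /(std0 _ (suppm c)) c0 i.
  have := congr1 (mcoeff (m i)) c0.
  rewrite mcoeff0 linear_sum (bigD1 i)//= big1.
    by rewrite addr0 mcoeffZ mcoeffX eqxx mulr1.
  by move=> j ji; rewrite mcoeffZ mcoeffX (inj_eq m_inj) (negPf ji) mulr0.
set r := \sum_i c i *: 'X_[m i] in cP; pose q := 'X_[a] - r.
have Sq : supported_in (standard_before a) q.
  move=> b /msuppB_le; rewrite mem_cat => /orP[|/suppm//].
  by rewrite msuppX inE => /eqP ->; split=> //; apply: mord_refl.
have q0 : 0 < L (q * q).
  rewrite lt_neqAle L_ge0 andbT eq_sym; apply/eqP => /(std0 _ Sq).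
  move=> /(congr1 (mcoeff a)).
  by rewrite mcoeffB mcoeffX eqxx ma subr0 mcoeff0 => /eqP; rewrite oner_eq0.
have Lrq : L (r * q) = 0.
  rewrite mulr_suml linear_sum big1// => i _.
  by rewrite -scalerAl linearZ /= (mulrC _ q) cP mulr0.
pose n := Num.sqrt (L (q * q)).
have n0 : 0 < n by rewrite sqrtr_gt0.
have nn : n * n = L (q * q) by rewrite -expr2 sqr_sqrtr// ltW.
exists (n^-1 *: q); split.
- by move=> b /msuppZ_le /Sq.
- by rewrite -scalerAl -scalerAr !linearZ /= -nn; field; rewrite gt_eqF.
- move=> b Sb ba; have : b \in s by rewrite memS ba andbT; apply/asboolP.
  move=> /(tnthP (in_tuple s))[i ->].
  by rewrite -scalerAr linearZ /= (mulrC _ q) cP mulr0.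
- have -> : 'X_[a] = q + r by rewrite /q subrK.
  rewrite -scalerAr linearZ /= mulrDl linearD /= Lrq addr0 -nn.
  by rewrite mulKf ?lt0r_neq0.
Qed.

(** The polynomial attached to the smaller of the two exponents is a combination
    of standard monomials that all come strictly before the larger one. *)
Lemma orthonormal_at_orthogonal a b p q : a != b ->
  orthonormal_at a p -> orthonormal_at b q -> L (p * q) = 0.
Proof.
wlog ab : a b p q / ord a b.
  move=> wl anb pa qb; have [ab|ba] := orP (mord_total mord a b).
    exact: wl ab _ _ _.
  by rewrite mulrC; apply: (wl b a) => //; rewrite eq_sym.
move=> anb pa qb; rewrite [p]mpolyE mulr_suml linear_sum big_seq big1// => m mp.
rewrite -scalerAl linearZ /=.
have [Lm ma] := oat_supp pa mp.
rewrite (oat_lower qb) ?mulr0//; first by split=> //; apply: (mord_trans mord) ab.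
apply: contraNneq anb => mb; apply/eqP/(mord_anti mord).
by rewrite ab -mb ma.
Qed.

End Orthonormalization.

(** * Existence of orthonormal polynomials *)

Theorem theorem3p3 (R : realType) (d : nat) (V : set 'rV[R]_d)
    (W : 'rV[R]_d -> R) (ord : rel 'X_{1..d})
    (countV : countable V)
    (isolV : forall x, V x -> isolated V x)
    (Wpos : forall x, V x -> 0 < W x)
    (Wsum : infinite_set V -> forall a : 'X_{1..d},
       (\esum_(x in V) (`|eval_at 'X_[a] x| * `|W x|)%:E < +oo)%E)
    (gord : graded_monomial_order ord) :
  exists P : 'X_{1..d} -> {mpoly R[d]}, orthonormal_polys ord V W P.
Proof.
pose L : {scalar {mpoly R[d]}} := HB.pack (Lfun V W)
  (GRing.isLinear.Build R {mpoly R[d]} R _ (Lfun V W) (Lfun_scalar Wsum)).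
have mord := gmord_order gord.
have [P PP] : {P : 'X_{1..d} -> {mpoly R[d]} &
    forall a, Lambda ord V a -> @orthonormal_at R d ord V L a (P a)}.
  apply: (@choice _ _ (fun a p =>
    Lambda ord V a -> @orthonormal_at R d ord V L a p)) => a.
  have [La|nLa] := pselect (Lambda ord V a); last by exists 0.
  have [p pP] := orthonormal_at_exists gord (L := L) (Lfun_sqr_ge0 Wpos Wsum)
    (Lfun_sqr_eq0 Wpos Wsum) La.
  by exists p.
have pairingE m n (f : 'cV_m) (g : 'cV_n) i j :
    pairing V W f g i j = L (f i 0 * g j 0).
  by rewrite !mxE big_ord1 !mxE.
have layerP k (i : 'I_(layer_size ord V k)) :
    Lambda ord V (layer_nth i) /\ mdeg (layer_nth i) = k.
  have := mem_tnth i (in_tuple (Lambda_layer ord V k)).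
  by rewrite mem_Lambda_layer => /andP[/eqP ? /asboolP].
have layer_inj k : injective (@layer_nth R d ord V k).
  by apply/tuple_uniqP; exact: Lambda_layer_uniq.
have layer_mono k (i j : 'I_(layer_size ord V k)) :
    (i < j)%N -> ord (layer_nth i) (layer_nth j).
  move=> ij; rewrite /layer_nth !(tnth_nth 0%MM).
  apply: (sorted_ltn_nth (mord_trans mord)) => //; rewrite ?inE//.
  by apply: sort_sorted; exact: mord_total mord.
exists P; split; first split.
- move=> a La; split.
    by apply: coord_space_supported => m /(oat_supp (PP a La))[].
  rewrite /Pi_le /= msizeE; apply/bigmax_leqP_seq => m mP _.
  by have [_ /(graded_mdeg gord)] := oat_supp (PP a La) mP.
- move=> k _; split.
    move=> l lk; apply/matrixP => i j; rewrite pairingE !mxE.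
    have [[Li di] [Lj dj]] := (layerP _ i, layerP _ j).
    rewrite (oat_lower (PP _ Lj))//.
      by split=> //; apply: (gmord_graded gord); rewrite di dj.
    by apply: contraTneq lk => ij; rewrite -di ij dj ltnn.
  (* The layer is listed in increasing order, so [oat_lower] kills every entry
     above the diagonal. *)
  rewrite unitmxE det_trig.
    rewrite unitfE prodf_seq_neq0; apply/allP => i _ /=.
    by rewrite pairingE !mxE; apply: oat_lead (PP _ (layerP _ i).1).
  apply/is_trig_mxP => i j ij; rewrite pairingE !mxE.
  have [[Li _] [Lj _]] := (layerP _ i, layerP _ j).
  rewrite (oat_lower (PP _ Lj))//; first by split=> //; apply: layer_mono.
  by rewrite (inj_eq (@layer_inj k)) neq_ltn ij.
- move=> k _; apply/matrixP => i j; rewrite pairingE !mxE.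
  have [[Li _] [Lj _]] := (layerP _ i, layerP _ j).
  have [->|ij] := eqVneq i j; first by rewrite (oat_norm (PP _ Lj)).
  apply: (orthonormal_at_orthogonal gord _ (PP _ Li) (PP _ Lj)).
  by rewrite (inj_eq (@layer_inj k)).
Qed.
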